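(* There exist universal constants $\nu>0$ and $c_0>0$ such that the following holds. Let $k,n$ be positive integers, let $\operatorname{Enc}:\{0,1\}^k\to\{0,1\}^n$ be any function, and let $L\le 2^{k^{0.9}}$, $\epsilon\in(k^{-\nu},\tfrac14)$ and $\delta\in(k^{-\nu},\tfrac13)$. Then every $(\tfrac12-\epsilon,L,q,\delta)$-local list-decoder for $\operatorname{Enc}$ satisfies $q\ge c_0\cdot\frac{\log(1/\delta)}{\epsilon^2}$, i.e. $q=\Omega\!\left(\frac{\log(1/\delta)}{\epsilon^2}\right)$.
   Context: For $x,y\in\{0,1\}^n$, $\mathrm{dist}(x,y)=|\{i\in[n]:x_i\ne y_i\}|/n$ is the relative Hamming distance. For $\operatorname{Enc}:\{0,1\}^k\to\{0,1\}^n$, $\alpha\ge 0$ and $w\in\{0,1\}^n$, let $\operatorname{List}_\alpha(w)=\{m\in\{0,1\}^k:\mathrm{dist}(\operatorname{Enc}(m),w)\le\alpha\}$. A randomized procedure $P(i,R)$ locally computes $m\in\{0,1\}^k$ with error $\delta$ if for every $i\in[k]$, $\Pr_R[P(i,R)=m_i]\ge 1-\delta$, where $R$ is a uniformly random string. An $(\alpha,L,q,\delta)$-local list-decoder for $\operatorname{Enc}$ is an oracle procedure $\operatorname{Dec}$ that, given oracle access to a word $w\in\{0,1\}^n$, makes at most $q$ (possibly adaptive) queries to $w$, and receives inputs $i\in[k]$, $j\in[L]$ and two random strings $r^{\mathrm{shared}},r$ (of arbitrary lengths), such that for every $w\in\{0,1\}^n$ and every $m\in\operatorname{List}_\alpha(w)$,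 with probability at least $2/3$ over a uniform choice of $r^{\mathrm{shared}}$ there exists $j\in[L]$ such that the procedure $(i,r)\mapsto\operatorname{Dec}^w(i,j,r^{\mathrm{shared}},r)$ locally computes $m$ with error $\delta$. *)

(* Defs.v *)
From HB Require Import structures.
From mathcomp Require Import all_boot all_order all_algebra.
From mathcomp Require Import reals exp.

Set Implicit Arguments.
Unset Strict Implicit.
Unset Printing Implicit Defensive.

Import Order.TTheory GRing.Theory Num.Theory.

Local Open Scope ring_scope.

Definition uniform_pr (R : realType) (T : finType) (A : pred T) : R :=
  #|A|%:R / #|T|%:R.

Definition dist (R : realType) (n : nat) (x y : n.-tuple bool) : R :=
  #|[set i : 'I_n | tnth x i != tnth y i]|%:R / n%:R.

Definition List (R : realType) (k n : nat) (Enc : k.-tuple bool -> n.-tuple bool)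
    (alpha : R) (w : n.-tuple bool) : {set k.-tuple bool} :=
  [set m | dist R (Enc m) w <= alpha].

(* An oracle computation with one output bit: [Query i f] asks for the bit at
   position [i] and continues with [f b] on answer [b], so later queries may
   depend on earlier answers. *)
Inductive oracle_comp (n : nat) : Type :=
| Return of bool
| Query of 'I_n & (bool -> oracle_comp n).

Fixpoint run (n : nat) (w : n.-tuple bool) (c : oracle_comp n) : bool :=
  match c with
  | Return b => b
  | Query i f => run w (f (tnth w i))
  end.

Fixpoint num_queries (n : nat) (w : n.-tuple bool) (c : oracle_comp n) : nat :=
  match c with
  | Return _ => 0%N
  | Query i f => (num_queries w (f (tnth w i))).+1
  end.

Definition locally_computes (R : realType) (k : nat) (T : finType)
    (P : 'I_k -> T -> bool) (m : k.-tuple bool) (delta : R) : bool :=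
  [forall i, 1 - delta <= uniform_pr R [pred r | P i r == tnth m i]].

(* [s] and [t] are the lengths of the shared and private random strings. *)
Definition local_list_decoder (R : realType) (k n : nat)
    (Enc : k.-tuple bool -> n.-tuple bool) (alpha : R) (L q : nat) (delta : R)
    (s t : nat)
    (Dec : 'I_k -> 'I_L -> s.-tuple bool -> t.-tuple bool -> oracle_comp n) :
    Prop :=
  (forall w i j rsh r, (num_queries w (Dec i j rsh r) <= q)%N) /\
  (forall (w : n.-tuple bool) (m : k.-tuple bool), m \in List Enc alpha w ->
     2 / 3 <= uniform_pr R [pred rsh : s.-tuple bool |
       [exists j : 'I_L,
         locally_computes (fun i r => run w (Dec i j rsh r)) m delta]]).

(* Main.v *)
(** Fix the shared randomness and [j], draw [m] uniformly and let [w] be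
    [Enc m] with each bit flipped independently with probability
    [(1 - 3 eps) / 2]; by Markov, [m] is in the list of [w] with probability at
    least [eps]. Run the decoder on [l] independent random indices [i]. If [m] is
    decoded well, all [l] answers are right with probability at least
    [(1 - delta) ^ l]. On the other hand, condition on the bits of [w] read so
    far and on the earlier answers being right. As long as this event has
    probability at least [exp (- xi k)], the posterior of [m] has density at most
    [exp (xi k)], so most bits [m_i] are still nearly unbiased. Were the unread
    bits of [w] uniform, the next answer would be independent of [m_i] and wrong
    with probability about [1/2]; passing from uniform to biased bits turns
    an event of probability [p] into one of probability at least
    [p ^ (3/2) * exp (- O (q eps ^ 2))]. The power [3/2] is small enough for
    [2 ^ (- 3/2) > 1/3], so for [q] below the claimed bound each new answer is
    wrong with probability at least [1.01 delta]. The events that are too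
    unlikely contribute at most [2 ^ (q l) * exp (- xi k)]. Hence [m] is decoded
    well from the fixed [j] with probability at most
    [exp (- delta l / 100) + exp (l (q + 1) - xi k)], and for
    [l] of order [k / (q + 1)] this beats the union bound over [L] values of
    [j]. *)

Require Import Defs.
From HB Require Import structures.
From mathcomp Require Import all_boot all_order all_algebra.
From mathcomp Require Import reals sequences exp.
From mathcomp Require Import ring lra.

Set Implicit Arguments.
Unset Strict Implicit.
Unset Printing Implicit Defensive.

Import Order.TTheory GRing.Theory Num.Theory.

Local Open Scope ring_scope.

(** * Product noise, subcubes and lazily sampled queries *)

Lemma sum_tuple_prod (R : realType) (n : nat) (Q : 'I_n -> pred bool)
    (F : 'I_n -> bool -> R) :
  \sum_(w : n.-tuple bool | [forall p, Q p (tnth w p)]) \prod_p F p (tnth w p)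
  = \prod_p \sum_(x | Q p x) F p x.
Proof.
rewrite bigA_distr_big_dep (reindex (@tuple_of_finfun bool n)); last first.
  exists (@finfun_of_tuple bool n) => f _.
    exact: tuple_of_finfunK.
  exact: finfun_of_tupleK.
apply: eq_big => [f|f _].
  by apply: eq_forallb => p; rewrite tnth_mktuple.
by apply: eq_bigr => p _; rewrite tnth_mktuple.
Qed.

Section NoisyWords.
Variables (R : realType) (n : nat).
Implicit Types (beta : R) (c w : n.-tuple bool) (p : 'I_n) (x : bool).
Implicit Types (sigma : 'I_n -> option bool) (T : oracle_comp n).

(** Binary symmetric channel, parametrized by its bias so that [beta = 0] is the uniform reference
    measure. *)
Definition bsc beta (x y : bool) : R :=
  if x == y then (1 + beta) / 2 else (1 - beta) / 2.

Definition noisy beta c w : R := \prod_p bsc beta (tnth c p) (tnth w p).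

Definition compat (o : option bool) (x : bool) : bool :=
  if o is Some y then x == y else true.

(** A partial assignment [sigma] records the answers read so far; their order is forgotten. *)
Definition cube sigma w : bool := [forall p, compat (sigma p) (tnth w p)].

Definition upd sigma p x : 'I_n -> option bool :=
  fun p' => if p' == p then Some x else sigma p'.

Definition cube_mass beta c sigma : R :=
  \sum_(w | cube sigma w) noisy beta c w.

Lemma bsc_ge0 beta x y : -1 <= beta <= 1 -> 0 <= bsc beta x y.
Proof. by rewrite /bsc => /andP[? ?]; case: (x == y); lra. Qed.

Lemma bsc0 x y : bsc 0 x y = 1 / 2 :> R.
Proof. by rewrite /bsc addr0 subr0 if_same. Qed.

Lemma sum_bsc beta x : \sum_y bsc beta x y = 1.
Proof. by rewrite big_bool /bsc; case: x => /=; field. Qed.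

Lemma noisy_ge0 beta c w : -1 <= beta <= 1 -> 0 <= noisy beta c w.
Proof. by move=> hb; apply: prodr_ge0 => p _; exact: bsc_ge0. Qed.

Lemma cube_massE beta c sigma :
  cube_mass beta c sigma =
  \prod_p \sum_(x | compat (sigma p) x) bsc beta (tnth c p) x.
Proof. exact: sum_tuple_prod. Qed.

Lemma cube_mass_ge0 beta c sigma : -1 <= beta <= 1 ->
  0 <= cube_mass beta c sigma.
Proof. by move=> hb; apply: sumr_ge0 => w _; exact: noisy_ge0. Qed.

Lemma cube_mass_le1 beta c sigma : -1 <= beta <= 1 ->
  cube_mass beta c sigma <= 1.
Proof.
move=> hb; rewrite cube_massE; apply: prodr_ile1 => p _; apply/andP; split.
  by apply: sumr_ge0 => x _; exact: bsc_ge0.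
rewrite -(sum_bsc beta (tnth c p)) [leRHS](bigID (compat (sigma p))) /= lerDl.
by apply: sumr_ge0 => x _; exact: bsc_ge0.
Qed.

Lemma cube_mass_full beta c : cube_mass beta c (fun=> None) = 1.
Proof. by rewrite cube_massE big1 // => p _; rewrite sum_bsc. Qed.

Lemma cube_full w : cube (fun=> None) w.
Proof. exact/forallP. Qed.

Lemma cube_mass_upd beta c sigma p x : sigma p = None ->
  cube_mass beta c (upd sigma p x) = bsc beta (tnth c p) x * cube_mass beta c sigma.
Proof.
move=> sp; rewrite !cube_massE (bigD1 p) //= [in RHS](bigD1 p) //= sp /=.
rewrite sum_bsc mul1r /upd eqxx big_pred1_eq; congr (_ * _).
by apply: eq_bigr => p' /negPf ->.
Qed.

Lemma cube_upd sigma p x w : sigma p = None ->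
  cube (upd sigma p x) w = cube sigma w && (tnth w p == x).
Proof.
move=> sp; apply/forallP/andP => [h|[/forallP h /eqP hx] p'].
  split; last by have := h p; rewrite /upd eqxx.
  apply/forallP => p'; have := h p'; rewrite /upd.
  by case: eqP => [->|//]; rewrite sp.
by rewrite /upd; case: eqP => [->|_]; [rewrite hx /=|exact: h].
Qed.

Lemma cube_fixed sigma p x w : sigma p = Some x -> cube sigma w -> tnth w p = x.
Proof. by move=> sp /forallP/(_ p); rewrite sp => /eqP. Qed.

Lemma cube_inhabited sigma : exists w, cube sigma w.
Proof.
exists [tuple odflt false (sigma p) | p < n]; apply/forallP => p.
by rewrite tnth_mktuple; case: (sigma p) => //= b.
Qed.

Lemma sum_cube_split (F : n.-tuple bool -> R) sigma p : sigma p = None ->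
  \sum_(w | cube sigma w) F w = \sum_x \sum_(w | cube (upd sigma p x) w) F w.
Proof.
move=> sp; rewrite (partition_big (fun w => tnth w p) predT) //=.
by apply: eq_bigr => x _; apply: eq_bigl => w; rewrite cube_upd.
Qed.

(* Probability that [T] returns [b] when the bits fixed by [sigma] are answered
   by [sigma] and the others are fresh noisy copies of those of [c]; a sampled
   bit is recorded so that repeated queries agree. *)
Fixpoint lazy_run beta c sigma T (b : bool) : R :=
  match T with
  | Return b' => (b' == b)%:R
  | Query p f =>
      if sigma p is Some x then lazy_run beta c sigma (f x) b
      else \sum_x bsc beta (tnth c p) x *
                  lazy_run beta c (upd sigma p x) (f x) b
  end.

(** Deferred decisions: given the bits in [sigma], the other noisy bits are independent, so drawing
    them on demand does not change the law of the answer. *)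
Lemma lazy_runE beta c sigma T b :
  \sum_(w | cube sigma w) noisy beta c w * (run w T == b)%:R =
  cube_mass beta c sigma * lazy_run beta c sigma T b.
Proof.
elim: T sigma => [b'|p f IH] sigma /=; first by rewrite -mulr_suml.
case sp: (sigma p) => [x|].
  rewrite -IH; apply: eq_bigr => w hw.
  by rewrite (cube_fixed sp hw).
rewrite (sum_cube_split _ sp) mulr_sumr; apply: eq_bigr => x _.
rewrite mulrCA mulrA -cube_mass_upd // -IH; apply: eq_bigr => w.
by rewrite cube_upd // => /andP[_ /eqP ->].
Qed.

Lemma lazy_run_ge0 beta c sigma T b : -1 <= beta <= 1 ->
  0 <= lazy_run beta c sigma T b.
Proof.
move=> hb; elim: T sigma => [b'|p f IH] sigma /=; first exact: ler0n.
by case: (sigma p) => //; apply: sumr_ge0 => x _; rewrite mulr_ge0 ?bsc_ge0.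
Qed.

Lemma lazy_runD beta c sigma T :
  lazy_run beta c sigma T true + lazy_run beta c sigma T false = 1.
Proof.
elim: T sigma => [b'|p f IH] sigma /=; first by case: b' => /=; rewrite ?addr0 ?add0r.
case: (sigma p) => //; rewrite -big_split /= -(sum_bsc beta (tnth c p)).
by apply: eq_bigr => x _; rewrite -mulrDr IH mulr1.
Qed.

(** At bias 0 fresh bits carry no trace of the codeword. This is what makes the reference answer
    independent of the message. *)
Lemma lazy_run_unbiased c c' sigma T b :
  lazy_run 0 c sigma T b = lazy_run 0 c' sigma T b.
Proof.
elim: T sigma => [b'|p f IH] sigma //=.
by case: (sigma p) => //; apply: eq_bigr => x _; rewrite IH !bsc0.
Qed.

Lemma num_queries_query sigma p f q :
    (forall w, cube sigma w -> (num_queries w (Query p f) <= q)%N) ->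
  exists2 q', q = q'.+1 &
    (forall x, sigma p = Some x ->
       forall w, cube sigma w -> (num_queries w (f x) <= q')%N) /\
    (sigma p = None -> forall x,
       forall w, cube (upd sigma p x) w -> (num_queries w (f x) <= q')%N).
Proof.
(* A cube is never empty, so some word witnesses the query and rules out [q = 0]. *)
case: q => [|q] h; first by have [w /h] := cube_inhabited sigma.
exists q => //; split=> [x sp w hw|sp x w].
  by have := h _ hw; rewrite /= (cube_fixed sp hw).
by rewrite cube_upd // => /andP[/h hw /eqP <-].
Qed.

End NoisyWords.

(** * Change of measure from uniform to biased bits *)

Section ChangeOfMeasure.
Variable R : realType.

(** Hoelder with exponents 3/2 and 3, applied to [u ^ 2 = (p u ^ 3) ^ (2/3) * p ^ (-2/3)] and
    likewise for [v]. The proof is an explicit identity with nonnegative terms. *)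
Lemma two_point_poly (p q u v : R) : 0 < p -> 0 < q -> 0 <= u -> 0 <= v ->
  p ^+ 2 * q ^+ 2 / (p ^+ 2 + q ^+ 2) * (u ^+ 2 + v ^+ 2) ^+ 3
    <= (p * u ^+ 3 + q * v ^+ 3) ^+ 2.
Proof.
move=> p0 q0 u0 v0.
have s0 : 0 < p ^+ 2 + q ^+ 2 by rewrite addr_gt0 ?exprn_gt0.
rewrite mulrAC ler_pdivrMr // -subr_ge0.
have -> : (p * u ^+ 3 + q * v ^+ 3) ^+ 2 * (p ^+ 2 + q ^+ 2) -
  p ^+ 2 * q ^+ 2 * (u ^+ 2 + v ^+ 2) ^+ 3 =
  p * u ^+ 3 * ((p * u - q * v) ^+ 2 * (p * u + 2 * (q * v))) +
  q * v ^+ 3 * ((q * v - p * u) ^+ 2 * (q * v + 2 * (p * u))).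
  by ring.
have pu : 0 <= p * u by rewrite mulr_ge0 // ltW.
have qv : 0 <= q * v by rewrite mulr_ge0 // ltW.
have h1 : 0 <= p * u + 2 * (q * v) by lra.
have h2 : 0 <= q * v + 2 * (p * u) by lra.
by rewrite addr_ge0 // mulr_ge0 ?(mulr_ge0 (sqr_ge0 _)) //
  mulr_ge0 ?exprn_ge0 // ltW.
Qed.

Lemma two_point (G p q a b x y : R) : 0 < p -> 0 < q -> 0 <= G ->
  0 <= a -> 0 <= b -> 0 <= x -> 0 <= y ->
  G * x ^+ 3 <= a ^+ 2 -> G * y ^+ 3 <= b ^+ 2 ->
  8 * (p ^+ 2 * q ^+ 2 / (p ^+ 2 + q ^+ 2)) * G * ((x + y) / 2) ^+ 3
    <= (p * a + q * b) ^+ 2.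
Proof.
move=> p0 q0 G0 a0 b0 x0 y0.
(* Writing [G], [x], [y] as squares turns the power 3/2 into a cube, as in [two_point_poly]. *)
have sqrE (r : R) : 0 <= r -> exists2 t : R, 0 <= t & r = t ^+ 2.
  by move=> r0; exists (Num.sqrt r); rewrite ?sqrtr_ge0 ?sqr_sqrtr.
have [s s0 ->] := sqrE _ G0; have [u u0 ->] := sqrE _ x0.
have [v v0 ->] := sqrE _ y0.
have root (z c : R) : 0 <= z -> 0 <= c ->
    s ^+ 2 * (z ^+ 2) ^+ 3 <= c ^+ 2 -> s * z ^+ 3 <= c.
  move=> z0 c0; rewrite -exprM mulnC exprM -exprMn ler_sqr // nnegrE.
  by rewrite mulr_ge0 ?exprn_ge0.
move=> /(root _ _ u0 a0) ha /(root _ _ v0 b0) hb.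
apply: (@le_trans _ _ ((p * (s * u ^+ 3) + q * (s * v ^+ 3)) ^+ 2)).
  have -> : p * (s * u ^+ 3) + q * (s * v ^+ 3)
          = s * (p * u ^+ 3 + q * v ^+ 3) by ring.
  have := ler_wpM2l (sqr_ge0 s) (two_point_poly p0 q0 u0 v0).
  move=> h; rewrite [leRHS]exprMn; apply: le_trans h.
  by rewrite le_eqVlt; apply/orP; left; apply/eqP; field;
     rewrite gt_eqF // addr_gt0 ?exprn_gt0.
rewrite ler_sqr ?nnegrE ?addr_ge0 ?mulr_ge0 ?exprn_ge0 ?(ltW p0) ?(ltW q0) //.
by rewrite lerD // ler_wpM2l // ltW.
Qed.

(* [8 p^2 q^2 / (p^2 + q^2)] for [p, q = (1 +- beta) / 2]: the constant of the
   two-point Hoelder inequality with exponent [3/2]. *)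
Definition tilt (beta : R) : R := (1 - beta ^+ 2) ^+ 2 / (1 + beta ^+ 2).

Lemma tilt_ge0 beta : 0 <= tilt beta.
Proof. by rewrite divr_ge0 ?sqr_ge0 // addr_ge0 ?sqr_ge0. Qed.

Lemma tilt_le1 beta : -1 <= beta <= 1 -> tilt beta <= 1.
Proof.
move=> hb; rewrite ler_pdivrMr ?mul1r; last by rewrite ltr_wpDr ?sqr_ge0.
have h0 := sqr_ge0 beta.
have h1 : beta ^+ 2 <= 1 by case/andP: hb => *; nra.
apply: (@le_trans _ _ 1); last by rewrite lerDl.
by rewrite expr_le1 ?lerBlDr ?lerDl //  subr_ge0.
Qed.

Lemma tiltE beta (p := (1 + beta) / 2) (q := (1 - beta) / 2) :
  tilt beta = 8 * (p ^+ 2 * q ^+ 2 / (p ^+ 2 + q ^+ 2)).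
Proof.
have h0 := sqr_ge0 beta; rewrite /tilt /p /q.
have e : ((1 + beta) / 2) ^+ 2 + ((1 - beta) / 2) ^+ 2 = (1 + beta ^+ 2) / 2
  by field.
rewrite e; field; rewrite gt_eqF //; lra.
Qed.

Lemma two_point_bsc (beta G : R) (x : bool) (a z : bool -> R) :
  -1 < beta < 1 -> 0 <= G -> (forall y, 0 <= a y) -> (forall y, 0 <= z y) ->
  (forall y, G * z y ^+ 3 <= a y ^+ 2) ->
  tilt beta * G * (\sum_y bsc 0 x y * z y) ^+ 3
    <= (\sum_y bsc beta x y * a y) ^+ 2.
Proof.
move=> hb G0 a0 z0 h; rewrite !big_bool !bsc0 tiltE /=.
have -> : 1 / 2 * z true + 1 / 2 * z false = (z true + z false) / 2 by field.
case: x; rewrite /bsc /=.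
  by apply: two_point => //; lra.
have -> : (1 - beta) / 2 * a true + (1 + beta) / 2 * a false =
          (1 + beta) / 2 * a false + (1 - beta) / 2 * a true by ring.
rewrite (addrC (z true)).
by apply: two_point => //; lra.
Qed.

(** Induction on the tree: each fresh query costs one factor [tilt beta] by the two-point
    inequality, and a repeated query costs nothing since [tilt beta <= 1]. Comparing a cube with a
    square avoids fractional powers. *)
Lemma change_of_measure n (beta : R) (c : n.-tuple bool) sigma
    (T : oracle_comp n) q b : -1 < beta < 1 ->
    (forall w, cube sigma w -> (num_queries w T <= q)%N) ->
  tilt beta ^+ q * lazy_run 0 c sigma T b ^+ 3
    <= lazy_run beta c sigma T b ^+ 2.
Proof.
move=> hb; have hb' : -1 <= beta <= 1 by lra.
have h0 : -1 <= (0 : R) <= 1 by lra.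
have t1 := exprn_ile1 _ (tilt_ge0 beta) (tilt_le1 hb').
elim: T sigma q => [b'|p f IH] sigma q.
  move=> _ /=; case: (b' == b); rewrite ?expr0n ?mulr0 // !expr1n mulr1.
  exact: t1.
case/num_queries_query => {}q -> [hS hN] /=.
case sp: (sigma p) => [x|].
  apply: le_trans (IH x _ q (hS _ sp)); rewrite ler_wpM2r //.
    by rewrite exprn_ge0 // lazy_run_ge0.
  by rewrite exprS ler_piMl ?tilt_le1 ?exprn_ge0 ?tilt_ge0.
rewrite exprS; apply: two_point_bsc => // [|y|y|y].
- by rewrite exprn_ge0 ?tilt_ge0.
- exact: lazy_run_ge0.
- exact: lazy_run_ge0.
- exact/IH/hN.
Qed.

End ChangeOfMeasure.

(** * Error of a single answer on a cube *)

Section OneStep.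
Variables (R : realType) (k n : nat) (Enc : k.-tuple bool -> n.-tuple bool).
Variables (beta : R) (hb : -1 < beta < 1).
Implicit Types (h : k.-tuple bool -> R) (sigma : 'I_n -> option bool).

Let hb' : -1 <= beta <= 1.
Proof. by case/andP: hb => *; rewrite !ltW. Qed.

Definition weight h sigma m : R := h m * cube_mass beta (Enc m) sigma.

Definition correlation (g : k.-tuple bool -> R) (i : 'I_k) : R :=
  \sum_(m : k.-tuple bool) (-1) ^+ (tnth m i : bool) * g m.

(** Each answer [b] has probability at least [a b] whatever the message, so either value of [m_i] is
    missed with a guaranteed probability. The mass minus the absolute correlation is twice the mass
    of the rarer value of [m_i]. *)
Lemma tree_error h sigma (T : oracle_comp n) q (i : 'I_k) :
    (forall m, 0 <= h m) ->
    (forall w, cube sigma w -> (num_queries w T <= q)%N) ->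
  (\sum_m weight h sigma m - `|correlation (weight h sigma) i|) *
     Num.sqrt (tilt beta ^+ q / 8)
  <= \sum_m h m * \sum_(w | cube sigma w)
       noisy beta (Enc m) w * (run w T != tnth m i)%:R.
Proof.
move=> h0 hq; pose c0 : n.-tuple bool := [tuple false | _ < n].
have h00 : -1 <= (0 : R) <= 1 by lra.
pose pi b := lazy_run 0 c0 sigma T b : R.
have pi0 b : 0 <= pi b by exact: lazy_run_ge0.
have tq0 : 0 <= tilt beta ^+ q by rewrite exprn_ge0 ?tilt_ge0.
pose a b := Num.sqrt (tilt beta ^+ q * pi b ^+ 3).
have a0 b : 0 <= a b by exact: sqrtr_ge0.
have aE b : a b ^+ 2 = tilt beta ^+ q * pi b ^+ 3.
  by rewrite sqr_sqrtr // mulr_ge0 // exprn_ge0.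
have g0 m : 0 <= weight h sigma m by rewrite mulr_ge0 ?cube_mass_ge0.
have ha m b : a b <= lazy_run beta (Enc m) sigma T b.
  rewrite -ler_sqr ?nnegrE ?lazy_run_ge0 // aE /pi (lazy_run_unbiased _ c0 (Enc m)).
  exact: change_of_measure.
pose G b := \sum_(m | tnth m i == b) weight h sigma m.
have split_m (F : k.-tuple bool -> R) :
    \sum_m F m = \sum_(m | tnth m i == true) F m + \sum_(m | tnth m i == false) F m.
  by rewrite (partition_big (fun m => tnth m i) predT) //= big_bool.
have low : G true * a false + G false * a true <= \sum_m h m *
    \sum_(w | cube sigma w) noisy beta (Enc m) w * (run w T != tnth m i)%:R.
  rewrite split_m !mulr_suml; apply: lerD; apply: ler_sum => m /eqP ->;
  rewrite -mulrA ler_wpM2l //.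
    rewrite (eq_bigr (fun w => noisy beta (Enc m) w * (run w T == false)%:R)).
      by rewrite lazy_runE ler_wpM2l ?cube_mass_ge0.
    by move=> w _; case: (run w T).
  rewrite (eq_bigr (fun w => noisy beta (Enc m) w * (run w T == true)%:R)).
    by rewrite lazy_runE ler_wpM2l ?cube_mass_ge0.
  by move=> w _; case: (run w T).
apply: le_trans low.
have -> : \sum_m weight h sigma m = G true + G false by rewrite split_m.
have -> : correlation (weight h sigma) i = G false - G true.
  rewrite /correlation split_m addrC /G -sumrN; congr (_ + _).
    by apply: eq_bigr => m /eqP ->; rewrite mul1r.
  by apply: eq_bigr => m /eqP ->; rewrite expr1 mulN1r.
have G0 b : 0 <= G b by apply: sumr_ge0.
(* [two_point] at [p = q = 1 / 2], where its constant is 1; since the two values of [pi] sum to 1,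
   their mean cubed is 1/8. *)
have est : Num.sqrt (tilt beta ^+ q / 8) <= (a true + a false) / 2.
  have half_gt0 : 0 < (1 / 2 : R) by lra.
  have := @two_point R (tilt beta ^+ q) _ _ (a true) (a false) (pi true) (pi false)
    half_gt0 half_gt0 tq0 (a0 _) (a0 _) (pi0 _) (pi0 _).
  rewrite !aE => /(_ (lexx _) (lexx _)); rewrite /pi lazy_runD.
  have s0 : 0 <= Num.sqrt (tilt beta ^+ q / 8) := sqrtr_ge0 _.
  have A0 : 0 <= (a true + a false) / 2 by rewrite divr_ge0 ?addr_ge0.
  move=> e; rewrite -(ler_sqr s0 A0) sqr_sqrtr; last by rewrite divr_ge0.
  have half2 : (1 / 2 : R) ^+ 2 + (1 / 2) ^+ 2 = 1 / 2 by field.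
  move: e; rewrite half2 -(mulrDr (1 / 2)); set t := tilt beta ^+ q => e.
  have -> : t / 8 = 8 * ((1 / 2) ^+ 2 * (1 / 2) ^+ 2 / (1 / 2)) * t * (1 / 2) ^+ 3.
    by field.
  by have -> : (a true + a false) / 2 = 1 / 2 * (a true + a false) by field.
move: est (G0 true) (G0 false) (a0 true) (a0 false).
set e := Num.sqrt _; set A := a true; set B := a false.
set g1 := G true; set g2 := G false => est ? ? ? ?.
have e0 : 0 <= e by exact: sqrtr_ge0.
have [le12|/ltW le21] := leP g1 g2.
  rewrite ger0_norm; last by lra.
  nra.
rewrite ler0_norm; last by lra.
nra.
Qed.

End OneStep.

(** * A level-one inequality for dense weights on messages *)

Section LevelOne.
Variable R : realType.

Lemma expR_half_bound (y : R) : -1 < y < 1 -> expR (2 * y) <= ((1 - y) ^+ 2)^-1.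
Proof.
move=> hy; have y1 : 0 < 1 - y by lra.
have -> : expR (2 * y) = (expR (- y) ^+ 2)^-1.
  by rewrite -expRM_natl -expRN; congr expR; ring.
rewrite lef_pV2 ?posrE ?exprn_gt0 ?expR_gt0 //.
rewrite ler_sqr ?nnegrE ?expR_ge0 ?(ltW y1) //.
exact: expR_ge1Dx.
Qed.

(** This is [cosh lam <= 1 + lam ^ 2]; the rational bounds at [y = lam / 2] and [- y] reduce it to a
    polynomial inequality. *)
Lemma expRD_expRN_le (lam : R) : 0 <= lam <= 1 / 2 ->
  expR lam + expR (- lam) <= 2 * (1 + lam ^+ 2).
Proof.
move=> hl; have [y hy ->] : exists2 y : R, 0 <= y <= 1 / 4 & lam = 2 * y.
  by exists (lam / 2); [lra | field].
have e1 : expR (2 * y) <= ((1 - y) ^+ 2)^-1 by apply: expR_half_bound; lra.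
have e2 : expR (- (2 * y)) <= ((1 + y) ^+ 2)^-1.
  rewrite -mulrN; have := @expR_half_bound (- y); rewrite opprK; apply; lra.
apply: le_trans (lerD e1 e2) _.
have p1 : 0 < 1 - y by lra.
have p2 : 0 < 1 + y by lra.
have -> : ((1 - y) ^+ 2)^-1 + ((1 + y) ^+ 2)^-1 =
   (2 * (1 + y ^+ 2)) / ((1 - y) ^+ 2 * (1 + y) ^+ 2).
  by field; rewrite !gt_eqF.
rewrite ler_pdivrMr ?mulr_gt0 ?exprn_gt0 // -mulrA ler_wpM2l //.
have z0 := sqr_ge0 y.
have z1 : y ^+ 2 <= 1 / 16 by case/andP: hy => *; nra.
have -> : (1 - y) ^+ 2 * (1 + y) ^+ 2 = (1 - y ^+ 2) ^+ 2 by ring.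
rewrite exprMn; move: (y ^+ 2) z0 z1 => z z0 z1.
have : 0 <= z * (1 - 7 * z) by rewrite mulr_ge0 //; lra.
have : 0 <= z ^+ 3 by rewrite exprn_ge0.
move=> h1 h2; rewrite -subr_ge0.
have -> : (1 + 2 ^+ 2 * z) * (1 - z) ^+ 2 - (1 + z) =
  z * (1 - 7 * z) + 4 * z ^+ 3 by ring.
by rewrite addr_ge0 // mulr_ge0.
Qed.

(* The tangent bound [y <= exp (y - a) + a - 1] turns the correlations into an
   exponential moment of a sum of independent signs. *)
Lemma level_one k (g : k.-tuple bool -> R) (lam xi : R) :
    0 < lam <= 1 / 2 -> (forall m, 0 <= g m <= 1) ->
    2 ^+ k * expR (- (xi * k%:R)) <= \sum_m g m ->
  \sum_i `|correlation g i| <= (xi / lam + lam) * k%:R * \sum_m g m.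
Proof.
move=> hl hg hG; set G := \sum_m g m in hG *.
(* With these signs the sum of absolute correlations is linear in [g]. *)
pose sb i := correlation g i < 0.
pose X (m : k.-tuple bool) : R :=
  \sum_i (-1) ^+ sb i * (-1) ^+ (tnth m i : bool).
have -> : \sum_i `|correlation g i| = \sum_m g m * X m.
  under [RHS]eq_bigr do rewrite mulr_sumr.
  rewrite exchange_big /=; apply: eq_bigr => i _.
  rewrite normrEsign mulr_sumr; apply: eq_bigr => m _; rewrite /sb; ring.
(* Chosen so that the moment bound times [exp (- a)] is exactly the assumed lower bound on [G]; the
   exponential term then costs one [G], which cancels the [- 1] of the tangent. *)
pose a := (xi + lam ^+ 2) * k%:R.
have moment : \sum_m expR (lam * X m) <= 2 ^+ k * expR (lam ^+ 2 * k%:R).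
  have -> : \sum_m expR (lam * X m) =
    \prod_(i < k) \sum_x expR (lam * ((-1) ^+ sb i * (-1) ^+ (x : bool))).
    rewrite -sum_tuple_prod; apply: eq_big => [m|m _]; first by apply/esym/forallP.
    by rewrite mulr_sumr expR_sum.
  have -> : 2 ^+ k * expR (lam ^+ 2 * k%:R) = \prod_(i < k) (2 * expR (lam ^+ 2)).
    by rewrite prodr_const card_ord exprMn -expRM_natr.
  apply: ler_prod => i _; rewrite big_bool /= !addr_ge0 ?expR_ge0 //=.
  apply: (@le_trans _ _ (2 * (1 + lam ^+ 2))); last first.
    by rewrite ler_wpM2l // expR_ge1Dx.
  have := @expRD_expRN_le lam; case: (sb i);
    rewrite ?expr1 ?expr0 ?mulN1r ?mul1r ?opprK ?mulrN1 ?mulr1 => h.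
    by apply: h; lra.
  by rewrite addrC; apply: h; lra.
have step m : lam * (g m * X m) <= expR (lam * X m) * expR (- a) + (a - 1) * g m.
  have /andP[g0 g1] := hg m; rewrite -expRD.
  have := expR_ge1Dx (lam * X m - a); have := expR_ge0 (lam * X m - a).
  by move: (expR _) => e e0 h; nra.
have tot : lam * \sum_m g m * X m <= a * G.
  rewrite mulr_sumr; apply: (@le_trans _ _
      (\sum_m (expR (lam * X m) * expR (- a) + (a - 1) * g m))).
    by apply: ler_sum => m _; exact: step.
  rewrite big_split /= -mulr_suml -mulr_sumr -/G.
  have : (\sum_m expR (lam * X m)) * expR (- a) <= G.
    apply: le_trans hG; apply: le_trans (ler_wpM2r (expR_ge0 _) moment) _.
    by rewrite -mulrA -expRD /a ler_wpM2l ?exprn_ge0 // ler_expR; lra.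
  by lra.
have l0 : 0 < lam by lra.
rewrite -(ler_pM2l l0); apply: le_trans tot _.
by rewrite /a le_eqVlt; apply/orP; left; apply/eqP; field; rewrite gt_eqF.
Qed.

End LevelOne.

(** * Repeated decoding with random indices *)

Section Iteration.
Variables (R : realType) (k n : nat) (Enc : k.-tuple bool -> n.-tuple bool).
Variables (beta : R) (hb : -1 < beta < 1).
Variables (S : finType) (D : 'I_k -> S -> oracle_comp n) (q : nat).
Hypothesis queries : forall w i r, (num_queries w (D i r) <= q)%N.
Hypotheses (k_gt0 : (0 < k)%N) (S_gt0 : (0 < #|S|)%N).
Implicit Types (h : k.-tuple bool -> R) (sigma : 'I_n -> option bool).
Implicit Types (A : k.-tuple bool -> n.-tuple bool -> R) (T : oracle_comp n).

Local Notation weight := (weight Enc beta).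

Let hb' : -1 <= beta <= 1.
Proof. by case/andP: hb => *; rewrite !ltW. Qed.

(** Left unnormalized so that splitting a cube is additive; [h] also absorbs the conditioning on
    earlier answers being right. *)
Definition expect h sigma A : R :=
  \sum_m h m * \sum_(w | cube sigma w) noisy beta (Enc m) w * A m w.

Definition correct (i : 'I_k) T : k.-tuple bool -> n.-tuple bool -> R :=
  fun m w => (run w T == tnth m i)%:R.

Lemma eq_expect h sigma A A' :
  (forall m w, cube sigma w -> A m w = A' m w) ->
  expect h sigma A = expect h sigma A'.
Proof.
move=> e; apply: eq_bigr => m _; congr (_ * _); apply: eq_bigr => w hw.
by rewrite e.
Qed.

Lemma ler_expect h sigma A A' : (forall m, 0 <= h m) ->
  (forall m w, A m w <= A' m w) -> expect h sigma A <= expect h sigma A'.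
Proof.
move=> h0 e; apply: ler_sum => m _; rewrite ler_wpM2l //.
by apply: ler_sum => w _; rewrite ler_wpM2l ?noisy_ge0.
Qed.

Lemma expect1 h sigma : expect h sigma (fun _ _ => 1) = \sum_m weight h sigma m.
Proof.
by apply: eq_bigr => m _; congr (_ * _); apply: eq_bigr => w _; rewrite mulr1.
Qed.

Lemma expect_split h sigma A p : sigma p = None ->
  expect h sigma A = \sum_x expect h (upd sigma p x) A.
Proof.
move=> sp; rewrite exchange_big /=; apply: eq_bigr => m _.
by rewrite (sum_cube_split _ sp) mulr_sumr.
Qed.

Lemma expect_sum (I : finType) h sigma (F : I -> k.-tuple bool -> n.-tuple bool -> R) :
  expect h sigma (fun m w => \sum_i F i m w) = \sum_i expect h sigma (F i).
Proof.
rewrite [RHS]exchange_big /=; apply: eq_bigr => m _.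
rewrite -mulr_sumr exchange_big /=; congr (_ * _).
by apply: eq_bigr => w _; rewrite mulr_sumr.
Qed.

Lemma expectZ h sigma A (a : R) :
  expect h sigma (fun m w => a * A m w) = a * expect h sigma A.
Proof.
rewrite mulr_sumr; apply: eq_bigr => m _; rewrite [RHS]mulrCA [in RHS]mulr_sumr.
by congr (_ * _); apply: eq_bigr => w _; rewrite mulrCA.
Qed.

(* [T] cuts a cube into at most [2 ^ l] subcubes on each of which its answer is
   constant, so an additive loss [Y] per cube is multiplied by at most [2 ^ l]. *)
Lemma tree_step A (Q Y : R) (i : 'I_k) T l h sigma : 0 <= Y ->
    (forall h' sigma', (forall m, 0 <= h' m <= 1) ->
       expect h' sigma' A <= Q * (\sum_m weight h' sigma' m) + Y) ->
    (forall m, 0 <= h m <= 1) ->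
    (forall w, cube sigma w -> (num_queries w T <= l)%N) ->
  expect h sigma (fun m w => correct i T m w * A m w)
    <= Q * expect h sigma (correct i T) + 2 ^+ l * Y.
Proof.
move=> Y0 hA h01; elim: T l sigma => [b|p f IH] l sigma.
  (* At a leaf the answer is constant, so its correctness depends on the message alone and can be
     moved into the weight. *)
  move=> _; pose h' m := h m * (b == tnth m i)%:R.
  have h'01 m : 0 <= h' m <= 1.
    have /andP[? ?] := h01 m; rewrite /h'; case: (_ == _) => /=; lra.
  have -> : expect h sigma (fun m w => correct i (Return n b) m w * A m w) =
            expect h' sigma A.
    apply: eq_bigr => m _; rewrite /h' -[RHS]mulrA [in RHS]mulr_sumr; congr (_ * _).
    by apply: eq_bigr => w _; rewrite mulrCA.
  have -> : expect h sigma (correct i (Return n b)) = \sum_m weight h' sigma m.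
    apply: eq_bigr => m _; rewrite /weight /h' -[RHS]mulrA; congr (_ * _).
    by rewrite -mulr_suml mulrC.
  apply: le_trans (hA _ _ h'01) _; rewrite lerD2l ler_peMl //.
  by rewrite exprn_ege1 // ler1n.
case/num_queries_query => {}l -> [hS hN].
case sp: (sigma p) => [x|].
  have e m w : cube sigma w -> correct i (Query p f) m w = correct i (f x) m w.
    by move=> hw; rewrite /correct /= (cube_fixed sp hw).
  rewrite (@eq_expect _ _ _ (fun m w => correct i (f x) m w * A m w)); last first.
    by move=> m w hw; rewrite e.
  rewrite (eq_expect h e); apply: le_trans (IH x _ _ (hS _ sp)) _.
  by rewrite lerD2l exprS ler_wpM2r // ler_peMl ?exprn_ge0 // ler1n.
have e x m w : cube (upd sigma p x) w -> correct i (Query p f) m w = correct i (f x) m w.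
  by rewrite cube_upd // => /andP[_ /eqP hx]; rewrite /correct /= hx.
rewrite !(expect_split _ _ sp).
have -> : 2 ^+ l.+1 * Y = \sum_(x : bool) 2 ^+ l * Y.
  by rewrite sumr_const card_bool exprS -mulrA mulr_natl.
rewrite mulr_sumr -big_split /=; apply: ler_sum => x _.
rewrite (@eq_expect _ _ _ (fun m w => correct i (f x) m w * A m w)); last first.
  by move=> m w hw; rewrite (e x).
rewrite (eq_expect h (e x)); exact/IH/hN.
Qed.

(** Success probability at a random index with random private coins; its [t]-th power is the
    probability that [t] independent runs are all right. *)
Definition accuracy (m : k.-tuple bool) (w : n.-tuple bool) : R :=
  (k%:R * #|S|%:R)^-1 * \sum_i \sum_r correct i (D i r) m w.

Let kS_gt0 : 0 < k%:R * #|S|%:R :> R.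
Proof. by rewrite mulr_gt0 ?ltr0n. Qed.

Lemma accuracy_ge0 m w : 0 <= accuracy m w.
Proof.
rewrite mulr_ge0 ?invr_ge0 ?(ltW kS_gt0) //.
by do 2 (apply: sumr_ge0 => ? _); rewrite ler0n.
Qed.

Lemma sum_const2 (a : R) : \sum_(i < k) \sum_(r : S) a = k%:R * #|S|%:R * a.
Proof.
by rewrite !sumr_const card_ord -mulrnA -[LHS]mulr_natl natrM [_ * k%:R]mulrC.
Qed.

Lemma accuracy_le1 m w : accuracy m w <= 1.
Proof.
rewrite /accuracy mulrC ler_pdivrMr // mul1r -[leRHS]mulr1 -sum_const2.
by do 2 (apply: ler_sum => ? _); rewrite /correct lern1 leq_b1.
Qed.

Lemma expect_accuracy h sigma A :
  expect h sigma (fun m w => accuracy m w * A m w) = (k%:R * #|S|%:R)^-1 *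
  \sum_i \sum_r expect h sigma (fun m w => correct i (D i r) m w * A m w).
Proof.
under [in RHS]eq_bigr do rewrite -expect_sum.
rewrite -expect_sum -expectZ; apply: eq_expect => m w _.
rewrite /accuracy -mulrA mulr_suml; congr (_ * _); apply: eq_bigr => i _.
by rewrite mulr_suml.
Qed.

Variables (lam xi e0 : R) (hl : 0 < lam <= 1 / 2).
Hypothesis e0_le : e0 <= (1 - (xi / lam + lam)) * Num.sqrt (tilt beta ^+ q / 8).
Let theta : R := 2 ^+ k * expR (- (xi * k%:R)).

Lemma expect_correct i T h sigma :
  expect h sigma (correct i T) = (\sum_m weight h sigma m) -
  \sum_m h m * \sum_(w | cube sigma w)
       noisy beta (Enc m) w * (run w T != tnth m i)%:R.
Proof.
rewrite -sumrB; apply: eq_bigr => m _; rewrite /weight -mulrBr -sumrB.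
congr (_ * _); apply: eq_bigr => w _; rewrite /correct.
by case: (_ == _); rewrite /= ?mulr1 ?mulr0 ?subr0 ?subrr.
Qed.

(** Averaging [tree_error] over [i]: by [level_one] the correlations take away at most a fraction
    [xi / lam + lam] of the mass. *)
Lemma average_step h sigma : (forall m, 0 <= h m <= 1) ->
  theta <= \sum_m weight h sigma m ->
  (k%:R * #|S|%:R)^-1 * \sum_i \sum_r expect h sigma (correct i (D i r))
    <= (1 - e0) * \sum_m weight h sigma m.
Proof.
move=> h01; set G := \sum_m weight h sigma m => hG.
rewrite mulrC ler_pdivrMr //.
have h0 m : 0 <= h m by case/andP: (h01 m).
have g01 m : 0 <= weight h sigma m <= 1.
  have /andP[? ?] := h01 m.
  by rewrite mulr_ge0 ?cube_mass_ge0 //= mulr_ile1 ?cube_mass_ge0 ?cube_mass_le1.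
have G0 : 0 <= G by apply: sumr_ge0 => m _; case/andP: (g01 m).
have lev := level_one hl g01 hG.
pose es : R := Num.sqrt (tilt beta ^+ q / 8).
have es0 : 0 <= es by exact: sqrtr_ge0.
apply: (@le_trans _ _ (\sum_(i < k) \sum_(r : S)
    (G - (G - `|correlation (weight h sigma) i|) * es))).
  apply: ler_sum => i _; apply: ler_sum => r _.
  rewrite expect_correct lerD2l lerN2; exact: tree_error.
under eq_bigr do rewrite sumr_const -mulr_natl.
have -> : (1 - e0) * G * (k%:R * #|S|%:R) = #|S|%:R * ((1 - e0) * G * k%:R).
  by ring.
rewrite -mulr_sumr ler_pM2l ?ltr0n //.
rewrite sumrB -mulr_suml sumrB sumr_const card_ord -mulr_natl.
move: lev; set c := \sum_i _; set kk : R := k%:R; set eta := xi / lam + lam.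
rewrite -/G => lev.
have kG : 0 <= kk * G by rewrite mulr_ge0.
have h1 : c * es <= eta * kk * G * es by rewrite ler_wpM2r.
have h2 : e0 * (kk * G) <= (1 - eta) * es * (kk * G) by rewrite ler_wpM2r.
lra.
Qed.

(** One factor is peeled off per step; [h] and [sigma] are general because the remaining factors are
    bounded on every subcube cut out by the peeled run. *)
Lemma expect_accuracyX t h sigma : e0 <= 1 -> (forall m, 0 <= h m <= 1) ->
  expect h sigma (fun m w => accuracy m w ^+ t)
    <= (1 - e0) ^+ t * (\sum_m weight h sigma m) + (2 ^+ q) ^+ t * theta.
Proof.
move=> e1; have th0 : 0 <= theta by rewrite mulr_ge0 ?exprn_ge0 ?expR_ge0.
elim: t h sigma => [|t IH] h sigma h01.
  rewrite -expect1 mul1r (@eq_expect _ _ _ (fun _ _ => 1)).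
    by rewrite lerDl mulr_ge0.
  by move=> *; rewrite expr0.
have h0 m : 0 <= h m by case/andP: (h01 m).
have e0' : 0 <= 1 - e0 by rewrite subr_ge0.
have G0 : 0 <= \sum_m weight h sigma m.
  by apply: sumr_ge0 => m _; rewrite mulr_ge0 ?cube_mass_ge0.
(* Below [theta] the density needed by [level_one] fails, and the whole mass is charged to the
   additive term. *)
have [hG|/ltW hG] := leP theta (\sum_m weight h sigma m); last first.
  apply: (@le_trans _ _ theta); last first.
    apply: (@le_trans _ _ ((2 ^+ q) ^+ t.+1 * theta)).
      by rewrite ler_peMl // exprn_ege1 // exprn_ege1 // ler1n.
    by rewrite lerDr mulr_ge0 ?exprn_ge0.
  apply: le_trans hG; rewrite -expect1; apply: ler_expect => // m w.
  by rewrite exprn_ile1 ?accuracy_ge0 ?accuracy_le1.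
rewrite (@eq_expect _ _ _ (fun m w => accuracy m w * accuracy m w ^+ t)); last first.
  by move=> *; rewrite exprS.
rewrite expect_accuracy.
set Q := (1 - e0) ^+ t; set Y := (2 ^+ q) ^+ t * theta.
have Y0 : 0 <= Y by rewrite mulr_ge0 ?exprn_ge0.
apply: (@le_trans _ _ ((k%:R * #|S|%:R)^-1 * \sum_(i < k) \sum_(r : S)
   (Q * expect h sigma (correct i (D i r)) + 2 ^+ q * Y))).
  rewrite ler_wpM2l ?invr_ge0 ?(ltW kS_gt0) //.
  apply: ler_sum => i _; apply: ler_sum => r _.
  by apply: tree_step => // w _; exact: queries.
under eq_bigr do rewrite big_split /= -mulr_sumr.
rewrite big_split /= -mulr_sumr sum_const2 mulrDr mulKf ?gt_eqF //.
rewrite exprS [(2 ^+ q) ^+ t.+1]exprS -(mulrA (2 ^+ q)) lerD2r.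
rewrite mulrCA -/Q [(1 - e0) * Q]mulrC -mulrA ler_wpM2l ?exprn_ge0 //.
exact: average_step.
Qed.

End Iteration.

(** * Distance of a noisy codeword *)

Lemma sum_indicator (R : realType) (T : finType) (P : pred T) :
  \sum_x (P x)%:R = #|P|%:R :> R.
Proof.
by rewrite -natr_sum -sum1_card [in RHS]big_mkcond; congr (_ %:R);
   apply: eq_bigr => x _; rewrite unfold_in; case: (P x).
Qed.

Lemma expect_dist (R : realType) n (beta : R) (c : n.-tuple bool) : (0 < n)%N ->
  \sum_w noisy beta c w * dist R c w = (1 - beta) / 2.
Proof.
move=> n0; have n0' : 0 < n%:R :> R by rewrite ltr0n.
have flip p : \sum_w noisy beta c w * (tnth c p != tnth w p)%:R = (1 - beta) / 2.
  have -> : (1 - beta) / 2 =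
      cube_mass beta c (upd (fun=> None) p (~~ tnth c p)).
    by rewrite cube_mass_upd // cube_mass_full mulr1 /bsc; case: (tnth c p).
  rewrite /cube_mass [RHS]big_mkcond; apply: eq_bigr => w _.
  rewrite cube_upd // cube_full /=.
  by case: (tnth c p); case: (tnth w p); rewrite /= ?mulr1 ?mulr0.
have distE w : dist R c w = n%:R^-1 * \sum_p (tnth c p != tnth w p)%:R.
  by rewrite /dist mulrC sum_indicator cardsE.
under eq_bigr do rewrite distE mulrCA mulr_sumr.
rewrite -mulr_sumr exchange_big /=.
under eq_bigr do rewrite flip.
by rewrite sumr_const card_ord -[X in _ * X]mulr_natl mulKf ?gt_eqF.
Qed.

(** Markov: the mean distance is [1 / 2 - 3 eps / 2], so far words have mass at most
    [(1 - 3 eps) / (1 - 2 eps)], which leaves [eps / (1 - 2 eps) >= eps]. *)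
Lemma close_prob (R : realType) n (eps : R) (c : n.-tuple bool) :
    (0 < n)%N -> 0 < eps < 1 / 4 ->
  eps <= \sum_(w | dist R c w <= 1 / 2 - eps) noisy (3 * eps) c w.
Proof.
move=> n0 he; have hb : -1 <= 3 * eps <= 1 by lra.
have tot : \sum_w noisy (3 * eps) c w = 1.
  rewrite -[RHS](cube_mass_full (3 * eps) c) /cube_mass.
  by apply: eq_bigl => w; rewrite cube_full.
have ex := expect_dist (3 * eps) c n0.
move: tot ex; rewrite (bigID (fun w => dist R c w <= 1 / 2 - eps)) /=.
rewrite [X in _ -> X = _ -> _](bigID (fun w => dist R c w <= 1 / 2 - eps)) /=.
set P := \sum_(w | _) noisy _ _ _; set F := \sum_(w | ~~ _) noisy _ _ _.
set A := \sum_(w | _) _; set B := \sum_(w | ~~ _) _ => tot ex.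
have A0 : 0 <= A.
  by apply: sumr_ge0 => w _; rewrite mulr_ge0 ?noisy_ge0 // divr_ge0.
have FB : (1 / 2 - eps) * F <= B.
  rewrite mulr_sumr; apply: ler_sum => w; rewrite -ltNge => /ltW hw.
  by rewrite mulrC ler_wpM2l ?noisy_ge0.
nra.
Qed.

(** * From repeated decoding to a bound on list decoders *)

Section Decoding.
Variables (R : realType) (k n : nat) (Enc : k.-tuple bool -> n.-tuple bool).
Variables (eps delta : R) (q : nat).
Hypotheses (k_gt0 : (0 < k)%N) (n_gt0 : (0 < n)%N).
Hypotheses (heps : 0 < eps < 1 / 4) (hdelta : 0 < delta < 1 / 3).

(** As [xi = lam ^ 2], the loss [xi / lam + lam] is 1/100, hence the factor 99/100 in
    [few_queries]. *)
Let lam : R := 1 / 200.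
Let xi : R := (1 / 200) ^+ 2.

Hypothesis few_queries :
  101 / 100 * delta <= 99 / 100 * Num.sqrt (tilt (3 * eps) ^+ q / 8).

Let hb : -1 < 3 * eps < 1.
Proof. by move: heps => ?; lra. Qed.

Let hb' : -1 <= 3 * eps <= 1.
Proof. by move: heps => ?; lra. Qed.

Definition good (S : finType) (D : 'I_k -> S -> oracle_comp n) m w :=
  locally_computes (fun i r => run w (D i r)) m delta.

Lemma good_accuracy (S : finType) (D : 'I_k -> S -> oracle_comp n) m w :
  (0 < #|S|)%N -> good D m w -> 1 - delta <= accuracy R D m w.
Proof.
move=> S0 /forallP hg.
have k0 : 0 < k%:R :> R by rewrite ltr0n.
have S0' : 0 < #|S|%:R :> R by rewrite ltr0n.
rewrite /accuracy mulrC ler_pdivlMr ?mulr_gt0 //.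
rewrite mulrA -mulrAC mulrC mulr_natl -[k in _ *+ k]card_ord -sumr_const.
apply: ler_sum => i _; have := hg i.
by rewrite /uniform_pr ler_pdivlMr // /correct sum_indicator.
Qed.

(** The [t]-th moment of the accuracy is at least [(1 - delta) ^ t] times the good mass; dividing
    the upper bound by this factor gives the claim. *)
Lemma good_prob (S : finType) (D : 'I_k -> S -> oracle_comp n) t :
    (0 < #|S|)%N -> (forall w i r, (num_queries w (D i r) <= q)%N) ->
  \sum_m \sum_w noisy (3 * eps) (Enc m) w * (good D m w)%:R <=
  2 ^+ k * (expR (- (delta / 100 * t%:R)) + expR (t%:R * (q%:R + 1) - xi * k%:R)).
Proof.
move=> S0 hq; set P := \sum_m _.
have d1 : 0 < 1 - delta by move: hdelta => ?; lra.
have up : (1 - delta) ^+ t * P <= (1 - 101 / 100 * delta) ^+ t * 2 ^+ k +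
    (2 ^+ q) ^+ t * (2 ^+ k * expR (- (xi * k%:R))).
  have hl : 0 < lam <= 1 / 2 by rewrite /lam; lra.
  have he : 101 / 100 * delta <=
      (1 - (xi / lam + lam)) * Num.sqrt (tilt (3 * eps) ^+ q / 8).
    have -> // : 1 - (xi / lam + lam) = 99 / 100 by rewrite /xi /lam; field.
  have e1 : 101 / 100 * delta <= 1 by move: hdelta => ?; lra.
  have h01 : forall m : k.-tuple bool, 0 <= (fun=> 1 : R) m <= 1.
    by move=> m; rewrite ler01 lexx.
  have := expect_accuracyX Enc hb hq k_gt0 S0 hl he t (fun=> None) e1 h01.
  have -> : \sum_m weight Enc (3 * eps) (fun=> 1) (fun=> None) m = 2 ^+ k.
    under eq_bigr do rewrite /weight cube_mass_full mulr1.
    by rewrite sumr_const card_tuple card_bool natrX.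
  apply: le_trans; rewrite mulr_sumr; apply: ler_sum => m _.
  rewrite mul1r mulr_sumr [leRHS]big_mkcond /=; apply: ler_sum => w _.
  rewrite cube_full mulrCA ler_wpM2l ?noisy_ge0 //.
  case: (boolP (good D m w)) => [hg|_]; rewrite ?mulr1 ?mulr0.
    by rewrite lerXn2r ?nnegrE ?(ltW d1) ?accuracy_ge0 ?good_accuracy.
  by rewrite exprn_ge0 ?accuracy_ge0.
rewrite -(ler_pM2l (exprn_gt0 t d1)); apply: le_trans up _.
have b1 : (1 - 101 / 100 * delta) ^+ t <=
          (1 - delta) ^+ t * expR (- (delta / 100 * t%:R)).
  rewrite [leRHS]mulrC -[in leRHS]mulNr expRM_natr -exprMn; apply: lerXn2r.
  - by rewrite nnegrE; move: hdelta => ?; lra.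
  - by rewrite nnegrE mulr_ge0 ?expR_ge0 ?ltW.
  - have := expR_ge1Dx (- (delta / 100)); move: hdelta => ?; nra.
(* The extra 1 in the exponent pays for the division: [(1 - delta) * exp 1 >= 4 / 3]. *)
have b2 : (2 ^+ q) ^+ t <= (1 - delta) ^+ t * expR (t%:R * (q%:R + 1)).
  rewrite expRM_natl -exprMn; apply: lerXn2r.
  - by rewrite nnegrE exprn_ge0.
  - by rewrite nnegrE mulr_ge0 ?expR_ge0 ?ltW.
  - have e2 : 2 <= expR 1 :> R by have := expR_ge1Dx (1 : R); lra.
    rewrite expRD mulrCA -{1}[2 ^+ q]mulr1 ler_pM ?exprn_ge0 //.
      by rewrite -[q%:R]mulr1 expRM_natl lerXn2r ?nnegrE ?expR_ge0.
    by move: hdelta => ?; nra.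
rewrite expRD mulrDr mulrDr lerD //.
  by rewrite mulrC mulrCA ler_wpM2l ?exprn_ge0.
rewrite mulrCA [leRHS]mulrCA ler_wpM2l ?exprn_ge0 // mulrA.
by rewrite ler_wpM2r ?expR_ge0.
Qed.

(** Double counting of the good triples of message, word and shared string: [close_prob] times 2/3
    from below, a union bound over [j] from above. *)
Lemma decoder_bound L s t (Dec : 'I_k -> 'I_L -> s.-tuple bool -> t.-tuple bool ->
    oracle_comp n) l :
  local_list_decoder Enc (1 / 2 - eps) q delta Dec ->
  2 / 3 * eps <= L%:R *
    (expR (- (delta / 100 * l%:R)) + expR (l%:R * (q%:R + 1) - xi * k%:R)).
Proof.
case=> hq hdec; set B := _ + _.
have card0 u : (0 < #|{: u.-tuple bool}|)%N by rewrite card_tuple card_bool expn_gt0.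
set N : R := #|{: s.-tuple bool}|%:R.
have N0 : 0 < N by rewrite ltr0n.
have k2 : 0 < 2 ^+ k :> R by rewrite exprn_gt0.
pose ok rsh j m w : R := (good (fun i r => Dec i j rsh r) m w)%:R.
rewrite -(ler_pM2l k2).
apply: (@le_trans _ _ (\sum_m \sum_w noisy (3 * eps) (Enc m) w *
   (N^-1 * \sum_rsh \sum_j ok rsh j m w))).
  have -> : 2 ^+ k * (2 / 3 * eps) = \sum_(m : k.-tuple bool) (2 / 3 * eps).
    by rewrite sumr_const card_tuple card_bool -[RHS]mulr_natl natrX.
  apply: ler_sum => m _.
  apply: (@le_trans _ _ (\sum_(w | dist R (Enc m) w <= 1 / 2 - eps)
      noisy (3 * eps) (Enc m) w * (2 / 3))).
    rewrite -mulr_suml mulrC ler_wpM2r ?divr_ge0 //; exact: close_prob.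
  rewrite big_mkcond; apply: ler_sum => w _; case: ifPn => hw.
    rewrite ler_wpM2l ?noisy_ge0 //.
    have := hdec w m; rewrite inE => /(_ hw); rewrite /uniform_pr -/N => hpr.
    apply: le_trans hpr _; rewrite [leRHS]mulrC ler_wpM2r ?invr_ge0 ?(ltW N0) //.
    rewrite -sum_indicator; apply: ler_sum => rsh _ /=.
    case: (boolP [exists _, _]) => [/existsP[j hj]|_].
      rewrite (bigD1 j) //= /ok /good hj lerDl.
      by apply: sumr_ge0 => ? _; rewrite ler0n.
    by apply: sumr_ge0 => ? _; rewrite ler0n.
  rewrite mulr_ge0 ?noisy_ge0 // mulr_ge0 ?invr_ge0 ?(ltW N0) //.
  by apply: sumr_ge0 => ? _; apply: sumr_ge0 => ? _; rewrite ler0n.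
have -> : \sum_m \sum_w noisy (3 * eps) (Enc m) w *
     (N^-1 * \sum_rsh \sum_j ok rsh j m w) =
   N^-1 * \sum_rsh \sum_j \sum_m \sum_w noisy (3 * eps) (Enc m) w * ok rsh j m w.
  rewrite [RHS]mulr_sumr.
  under [RHS]eq_bigr do rewrite exchange_big mulr_sumr /=.
  rewrite [RHS]exchange_big /=; apply: eq_bigr => m _.
  under [RHS]eq_bigr do rewrite exchange_big mulr_sumr /=.
  rewrite [RHS]exchange_big /=; apply: eq_bigr => w _.
  rewrite mulrCA -mulr_sumr; congr (_ * _); rewrite mulr_sumr.
  by apply: eq_bigr => rsh _; rewrite mulr_sumr.
rewrite mulrC ler_pdivrMr //.
apply: (@le_trans _ _ (\sum_(rsh : s.-tuple bool) \sum_(j < L) 2 ^+ k * B)).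
  apply: ler_sum => rsh _; apply: ler_sum => j _.
  by apply: good_prob => // *; exact: hq.
rewrite !sumr_const card_ord -!mulrnA -[leLHS]mulr_natl natrM -/N.
by rewrite le_eqVlt; apply/orP; left; apply/eqP; ring.
Qed.

End Decoding.

(** * Numerical estimates and the choice of the number of runs *)

Lemma tilt_ge (R : realType) (eps : R) : 0 < eps < 1 / 4 ->
  expR (- (63 * eps ^+ 2)) <= tilt (3 * eps).
Proof.
move=> he; rewrite /tilt; set x := (3 * eps) ^+ 2.
have x0 : 0 <= x by exact: sqr_ge0.
have x1 : x <= 9 / 16 by rewrite /x; case/andP: he => *; nra.
(* [63 = 7 * 9]: each factor [1 - x] costs [3 x], and [1 / (1 + x)] costs [x]. *)
have -> : - (63 * eps ^+ 2) = - (3 * x) + - (3 * x) + - x by rewrite /x; ring.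
have e1 : expR (- (3 * x)) <= 1 - x.
  rewrite expRN -div1r ler_pdivrMr ?expR_gt0 //.
  have := expR_ge1Dx (3 * x); nra.
have e2 : expR (- x) <= (1 + x)^-1.
  by rewrite expRN lef_pV2 ?posrE ?expR_gt0 ?expR_ge1Dx //; lra.
by rewrite !expRD expr2 !ler_pM ?mulr_ge0 ?expR_ge0.
Qed.

Lemma few_queries_error (R : realType) (eps delta : R) (q : nat) :
    0 < eps < 1 / 4 -> 0 < delta < 1 / 3 ->
    3200 * (eps ^+ 2 * q%:R) <= ln (1 / delta) ->
  101 / 100 * delta <= 99 / 100 * Num.sqrt (tilt (3 * eps) ^+ q / 8).
Proof.
move=> he hd; set l := ln _ => hq.
have d0 : 0 < delta by lra.
have dE : delta = expR (- l).
  by rewrite /l div1r lnV ?posrE // opprK lnK.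
have t0 : 0 <= tilt (3 * eps) ^+ q by rewrite exprn_ge0 ?tilt_ge0.
(* Here [63 / 3200 < 1 / 50]. *)
have tq : expR (- (l / 50)) <= tilt (3 * eps) ^+ q.
  apply: (@le_trans _ _ (expR (- (63 * eps ^+ 2)) ^+ q)).
    rewrite -expRM_natr ler_expR.
    have : 0 <= eps ^+ 2 * q%:R by rewrite mulr_ge0 ?sqr_ge0.
    by lra.
  by rewrite lerXn2r ?nnegrE ?expR_ge0 ?tilt_ge0 ?tilt_ge.
have l3 : ln 3 <= l.
  by rewrite ler_ln ?posrE ?divr_gt0 // ler_pdivlMr //; lra.
have ln3 : ln 3 <= 2 :> R.
  have := @le_ln1Dx R 2; have -> : 1 + 2 = 3 :> R by ring.
  by apply; lra.
(* As [delta < 1 / 3], [delta ^ (- 99 / 50)] is at least [9 * (1 - 2 / 50) = 8.64], above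
   [8 * (101 / 99) ^ 2]. *)
have main : 8 * (101 / 99 * delta) ^+ 2 <= expR (- (l / 50)).
  have -> : expR (- (l / 50)) = delta ^+ 2 * expR (99 / 50 * l).
    by rewrite dE -expRM_natl -expRD; congr expR; field.
  have : 9 * (1 - 2 / 50) <= expR (99 / 50 * l).
    apply: (@le_trans _ _ (expR (99 / 50 * ln 3))); last by rewrite ler_expR; lra.
    have -> : 99 / 50 * ln 3 = 2%:R * ln 3 + - (ln 3 / 50) :> R by field.
    rewrite expRD expRM_natl lnK ?posrE //.
    have := expR_ge1Dx (- (ln 3 / 50) : R); move: (expR _) => z hz.
    lra.
  have : 0 < delta ^+ 2 by rewrite exprn_gt0.
  by move: (expR _) => z; nra.
have s0 : 0 <= Num.sqrt (tilt (3 * eps) ^+ q / 8) := sqrtr_ge0 _.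
have r0 : 0 <= 101 / 99 * delta by lra.
have : 101 / 99 * delta <= Num.sqrt (tilt (3 * eps) ^+ q / 8).
  rewrite -(ler_sqr r0 s0) sqr_sqrtr; last by rewrite divr_ge0.
  by rewrite ler_pdivlMr // mulrC; apply: le_trans tq.
by lra.
Qed.

Lemma pow2_le_expR (R : realType) (x : R) : 0 <= x -> 2 `^ x <= expR x.
Proof.
move=> x0; rewrite /powR (gt_eqF (ltr0n R 2)) ler_expR ler_piMr //.
by have := @le_ln1Dx R 1; have -> : 1 + 1 = 2 :> R by []; apply; lra.
Qed.

(** In the margin, [K ^ 180] will beat the list size and [3 K] the factor [eps]. *)
Lemma iterations_exist (R : realType) (K delta : R) (q : nat) : 4 < K ->
    K^-1 < delta -> q%:R + 1 <= K ^+ 3 ->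
  exists l : nat, K ^+ 180 + 3 * K <= delta / 100 * l%:R /\
    l%:R * (q%:R + 1) - (1 / 200) ^+ 2 * K ^+ 200 <= - (K ^+ 180 + 3 * K).
Proof.
move=> K4 hd hq; have K0 : 0 < K by lra.
have Ki : 0 < K^-1 by rewrite invr_gt0.
have big : 10 * 200 ^+ 3 <= K ^+ 16.
  have K256 : 256 <= K ^+ 4.
    have -> : 256 = 4 ^+ 4 :> R by ring.
    by rewrite lerXn2r ?nnegrE ?(ltW K0) // ltW.
  have K200 : 200 <= K ^+ 4 by lra.
  have -> : K ^+ 16 = K ^+ 4 * (K ^+ 4) ^+ 3 by rewrite -exprM -exprD.
  apply: ler_pM => //; first by rewrite exprn_ge0.
    by lra.
  by rewrite lerXn2r ?nnegrE ?exprn_ge0 ?(ltW K0).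
have K1 j : 1 <= K ^+ j by rewrite exprn_ege1 //; lra.
have K180 : K <= K ^+ 180 by rewrite -[leLHS]expr1 ler_weXn2l //; lra.
have scale (u d : R) : 1 <= u -> 0 < d -> d <= 200 ^+ 3 ->
    10 * u <= K ^+ 16 * u / d.
  move=> u1 d0 hd'; rewrite ler_pdivlMr // mulrAC ler_wpM2r //; first by lra.
  by apply: le_trans big; rewrite ler_wpM2l.
have c3 : 2 * 200 ^+ 2 <= 200 ^+ 3 :> R by rewrite exprS ler_wpM2r ?exprn_ge0; lra.
(* With [q + 1 <= K ^ 3], this spends half of [xi k]; the powers of [K] to spare absorb all
   constants through [big]. *)
pose y : R := K ^+ 197 / (2 * 200 ^+ 2).
have y0 : 0 <= y by rewrite divr_ge0 ?mulr_ge0 ?exprn_ge0 // ltW.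
exists (Num.trunc y).
have [tl tu] : (Num.trunc y)%:R <= y /\ y < (Num.trunc y)%:R + 1.
  by have /andP[? ?] := truncn_itv y0; rewrite natr1.
split.
  apply: (@le_trans _ _ (K^-1 / 100 * (y - 1))).
    have -> : K^-1 / 100 * (y - 1) = K ^+ 196 / 200 ^+ 3 - K^-1 / 100.
      by rewrite /y (exprS K 196); field; rewrite gt_eqF.
    have Ki1 : K^-1 <= 1 by rewrite invf_le1 //; lra.
    have -> : K ^+ 196 = K ^+ 16 * K ^+ 180 by rewrite -exprD.
    have := scale _ (200 ^+ 3) (K1 180%N) (exprn_gt0 _ (ltr0n R 200)) (lexx _).
    have := K1 180%N; set v := K ^+ 16 * _ / _.
    by move: v (K ^+ 180) K180 => v u *; lra.
  apply: ler_pM; [by rewrite divr_ge0 // ltW| |lra|lra].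
  rewrite subr_ge0 /y.
  have -> : K ^+ 197 = K ^+ 16 * K ^+ 181 by rewrite -exprD.
  have d0 : 0 < 2 * 200 ^+ 2 :> R by rewrite mulr_gt0 ?exprn_gt0.
  apply: le_trans (scale _ _ (K1 181%N) d0 c3).
  by have := K1 181%N; move: (K ^+ 181) => u *; lra.
have : (Num.trunc y)%:R * (q%:R + 1) <= y * K ^+ 3.
  by apply: ler_pM; rewrite ?addr_ge0.
have -> : y * K ^+ 3 = K ^+ 200 / (2 * 200 ^+ 2) by rewrite /y mulrAC -exprD.
have -> : (1 / 200) ^+ 2 * K ^+ 200 =
    2 * (K ^+ 200 / (2 * 200 ^+ 2)) by field.
have -> : K ^+ 200 = K ^+ 16 * K ^+ 184 by rewrite -exprD.
have d0 : 0 < 2 * 200 ^+ 2 :> R by rewrite mulr_gt0 ?exprn_gt0.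
have := scale _ _ (K1 184%N) d0 c3.
have : K ^+ 180 <= K ^+ 184 by rewrite ler_weXn2l //; lra.
set v := K ^+ 16 * _ / _; have := K1 180%N.
by move: v (K ^+ 184) (K ^+ 180) K180 => v u z *; lra.
Qed.

(** * The query lower bound *)

Theorem theorem1p5 (R : realType) :
  exists nu c0 : R, [/\ 0 < nu, 0 < c0 &
    forall (k n : nat) (Enc : k.-tuple bool -> n.-tuple bool)
           (L q : nat) (eps delta : R) (s t : nat)
           (Dec : 'I_k -> 'I_L -> s.-tuple bool -> t.-tuple bool ->
                  oracle_comp n),
      (0 < k)%N -> (0 < n)%N ->
      L%:R <= 2 `^ (k%:R `^ (9 / 10)) :> R ->
      k%:R `^ (- nu) < eps < 1 / 4 ->
      k%:R `^ (- nu) < delta < 1 / 3 ->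
      local_list_decoder Enc (1 / 2 - eps) q delta Dec ->
      c0 * (ln (1 / delta) / eps ^+ 2) <= q%:R].
Proof.
(* [c0] is the constant of [few_queries_error]; [nu = 1 / 200] makes [k] and [k ^ 0.9] the integer
   powers 200 and 180 of [k ^ nu]. *)
exists (1 / 200), (1 / 3200); split; [by lra|by lra|].
move=> k n Enc L q eps delta s t Dec k0 n0 hL heps hdelta hdec.
rewrite leNgt; apply/negP => hq.
(* All quantities are powers of [K], and [K^-1 < eps < 1 / 4] forces [4 < K]. *)
pose K : R := k%:R `^ (1 / 200).
have kr0 : 0 < k%:R :> R by rewrite ltr0n.
have K0 : 0 < K by rewrite powR_gt0.
have KV : k%:R `^ (- (1 / 200)) = K^-1 by rewrite powRN.
rewrite KV in heps hdelta.
have Ki : 0 < K^-1 by rewrite invr_gt0.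
have he : 0 < eps < 1 / 4 by lra.
have hd : 0 < delta < 1 / 3 by lra.
have e0 : 0 < eps by lra.
have d0 : 0 < delta by lra.
have K4 : 4 < K.
  have : K^-1 < 1 / 4 by lra.
  by rewrite ltr_pdivlMr // mulrC ltr_pdivrMr // mul1r.
have kE : k%:R = K ^+ 200.
  rewrite -powR_mulrn ?(ltW K0) // -powRrM.
  have -> : 1 / 200 * 200%:R = 1 :> R by field.
  by rewrite powRr1 // ltW.
have k09 : k%:R `^ (9 / 10) = K ^+ 180.
  rewrite -powR_mulrn ?(ltW K0) // -powRrM; congr (_ `^ _).
  by field.
have e2 : 0 < eps ^+ 2 by rewrite exprn_gt0.
have hq1 : 3200 * (eps ^+ 2 * q%:R) <= ln (1 / delta).
  move: hq; rewrite mulrA ltr_pdivlMr // => hq; lra.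
have lnd : ln (1 / delta) <= K.
  have := @le_ln1Dx R (1 / delta - 1); rewrite addrCA subrr addr0 => h.
  apply: (@le_trans _ _ (1 / delta - 1)).
    by apply: h; rewrite ltrBrDl subrr divr_gt0.
  have : 1 / delta <= K by rewrite div1r -[K]invrK lef_pV2 ?posrE //; lra.
  by lra.
have hq3 : q%:R + 1 <= K ^+ 3.
  have Ke : 1 <= K * eps.
    by rewrite mulrC -ler_pdivrMr // div1r; lra.
  have Ke2 : 1 <= K ^+ 2 * eps ^+ 2 by rewrite -exprMn exprn_ege1.
  have qK : 3200 * q%:R <= K ^+ 3.
    apply: (@le_trans _ _ (K ^+ 2 * (3200 * (eps ^+ 2 * q%:R)))).
      have -> : K ^+ 2 * (3200 * (eps ^+ 2 * q%:R)) =
                (K ^+ 2 * eps ^+ 2) * (3200 * q%:R) by ring.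
      by rewrite ler_peMl // mulr_ge0.
    by rewrite (exprSr K 2) ler_wpM2l ?sqr_ge0 //; exact: le_trans lnd.
  have : 4 <= K ^+ 3.
    by rewrite (exprS K 2); have : 1 <= K ^+ 2 by [rewrite exprn_ege1 //; lra|]; nra.
  by have : 0 <= q%:R :> R by []; lra.
have hd1 : K^-1 < delta by lra.
have [l [l1 l2]] := iterations_exist K4 hd1 hq3.
have := decoder_bound k0 n0 he hd (few_queries_error he hd hq1) l hdec.
apply/negP; rewrite -ltNge.
set M := K ^+ 180 in k09 l1 l2 *.
have M0 : 0 <= M by rewrite exprn_ge0 // ltW.
have hL' : L%:R <= expR M.
  by apply: le_trans hL _; rewrite k09 pow2_le_expR.
(* The product is [2 exp (- 3 K) < 2 / (3 K) < 2 / 3 * eps], the contradiction. *)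
apply: (@le_lt_trans _ _ (expR M * (2 * expR (- (M + 3 * K))))).
  apply: ler_pM; rewrite ?addr_ge0 ?expR_ge0 // [leRHS]mulr_natl mulr2n.
  by apply: lerD; rewrite ler_expR ?lerN2 // kE.
rewrite mulrCA -expRD.
have -> : M - (M + 3 * K) = - (3 * K) by ring.
have ex : expR (- (3 * K)) < (3 * K)^-1.
  rewrite expRN ltf_pV2 ?posrE ?expR_gt0 ?mulr_gt0 //.
  by apply: lt_le_trans (expR_ge1Dx _); rewrite ltrDr.
have : (3 * K)^-1 = K^-1 / 3 by rewrite invfM mulrC.
by lra.
Qed.
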